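(* Let $A$ be a ring such that the inclusion functor $e_* : \mathsf{E}(A) \to \mathsf{K}(\mathsf{Pro}\,A)$ has a right adjoint $e^! : \mathsf{K}(\mathsf{Pro}\,A) \to \mathsf{E}(A)$. Let $M$ be a left $A$-module which has a complete projective resolution $T$. Then the Tate Ext groups defined by $\operatorname{H}^i\operatorname{Hom}_A(e^!\operatorname{res} M, N)$ coincide with the Tate Ext groups of Avramov and Martsinkovsky defined by $\operatorname{H}^i\operatorname{Hom}_A(T,N)$; that is, for every left $A$-module $N$ and every $i \in \mathbb{Z}$, $$\operatorname{H}^i\operatorname{Hom}_A(e^!\operatorname{res} M, N) \cong \operatorname{H}^i\operatorname{Hom}_A(T,N).$$
   Context: Complexes are written cohomologically and may be unbounded. For a complex $X$ and a module $N$, $\operatorname{Hom}_A(X,N)$ is the complex with $\operatorname{Hom}_A(X^{-i},N)$ in cohomological degree $i$. $\mathsf{K}(\mathsf{Pro}\,A)$ is the homotopy category of complexes of projective left $A$-modules. $\mathsf{E}(A)$ is the class of complexes $E$ of left $A$-modules such that $E$ consists of projective modules, $E$ is exact, and $\operatorname{Hom}_A(E,Q)$ is exact for each projective left $A$-module $Q$. It is viewed as a full subcategory of $\mathsf{K}(\mathsf{Pro}\,A)$, with inclusion functor $e_*$. $\operatorname{res} : \mathsf{Mod}(A) \to \mathsf{K}(\mathsf{Pro}\,A)$ is a functor sending each left $A$-module to a projective resolution of it (concentrated in non-positive cohomological degrees), giving an equivalence of $\mathsf{Mod}(A)$ with the full subcategory of projective resolutions. A complete projective resolution of the left $A$-module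 $M$ is a complex $T$ in $\mathsf{E}(A)$ which consists of finitely generated modules and sits in a diagram of chain maps $T \xrightarrow{t} P \to M$ where $P \to M$ is a projective resolution and $t^i$ is bijective for $i \ll 0$. *)

(* Defs.v *)
From HB Require Import structures.
From mathcomp Require Import all_boot all_order all_algebra.
From mathcomp Require Import all_classical prodnormedzmodule.

Set Implicit Arguments.
Unset Strict Implicit.
Unset Printing Implicit Defensive.

Import GRing.Theory.
Local Open Scope ring_scope.
Local Open Scope quotient_scope.

Record category := Category {
  ob :> Type;
  hom : ob -> ob -> Type;
  idm : forall a, hom a a;
  cmp : forall a b c, hom b c -> hom a b -> hom a c;
  cmp1m : forall a b (f : hom a b), cmp (idm b) f = f;
  cmpm1 : forall a b (f : hom a b), cmp f (idm a) = f;
  cmpA : forall a b c d (h : hom c d) (g : hom b c) (f : hom a b),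
    cmp h (cmp g f) = cmp (cmp h g) f
}.
Arguments hom {c} a b : rename.
Arguments idm {c} a : rename.
Arguments cmp {c} {a0 b c0} _ _ : rename.

Record functor (C D : category) := Functor {
  fob :> C -> D;
  fmap : forall a b : C, hom a b -> hom (fob a) (fob b);
  fmap1 : forall a, fmap (idm a) = idm (fob a);
  fmapM : forall (a b c : C) (g : hom b c) (f : hom a b),
    fmap (cmp g f) = cmp (fmap g) (fmap f)
}.
Arguments fmap {C D} f {a b} _ : rename.

Section IdComp.
Variables C D E : category.

Definition idF : functor C C :=
  @Functor C C id (fun _ _ f => f) (fun _ => erefl) (fun _ _ _ _ _ => erefl).

Variables (G : functor D E) (F : functor C D).

Let compF_map (a b : C) (f : hom a b) : hom (G (F a)) (G (F b)) :=
  fmap G (fmap F f).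

Fact compF_map1 a : compF_map (idm a) = idm (G (F a)).
Proof. by rewrite /compF_map !fmap1. Qed.

Fact compF_mapM (a b c : C) (g : hom b c) (f : hom a b) :
  compF_map (cmp g f) = cmp (compF_map g) (compF_map f).
Proof. by rewrite /compF_map !fmapM. Qed.

Definition compF : functor C E :=
  @Functor C E (fun a => G (F a)) _ compF_map1 compF_mapM.

End IdComp.

Definition naturally_isomorphic (C D : category) (F G : functor C D) : Prop :=
  exists (u : forall a, hom (F a) (G a)) (v : forall a, hom (G a) (F a)),
    [/\ forall a, cmp (v a) (u a) = idm (F a),
        forall a, cmp (u a) (v a) = idm (G a)
      & forall a b (f : hom a b), cmp (fmap G f) (u a) = cmp (u b) (fmap F f)].

Definition equivalence (C D : category) (F : functor C D) : Prop :=
  exists G : functor D C,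
    naturally_isomorphic (compF G F) (idF C) /\
    naturally_isomorphic (compF F G) (idF D).

(* [adjunction F G] : the functor G is right adjoint to F. *)
Record adjunction (C D : category) (F : functor C D) (G : functor D C) :=
  Adjunction {
    adj_hom : forall (a : C) (b : D), hom (F a) b -> hom a (G b);
    adj_bij : forall a b, bijective (@adj_hom a b);
    adj_natl : forall (a a' : C) (b : D) (f : hom (F a) b) (g : hom a' a),
      adj_hom (cmp f (fmap F g)) = cmp (adj_hom f) g;
    adj_natr : forall (a : C) (b b' : D) (f : hom (F a) b) (g : hom b b'),
      adj_hom (cmp g f) = cmp (fmap G g) (adj_hom f)
  }.

Section FullSubcategory.
Variables (C : category) (P : C -> Prop).

Definition full_sub : category :=
  @Category {a : C | P a} (fun a b => hom (projT1 a) (projT1 b))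
    (fun a => idm (projT1 a)) (fun _ _ _ g f => cmp g f)
    (fun _ _ f => cmp1m f) (fun _ _ f => cmpm1 f)
    (fun _ _ _ _ h g f => cmpA h g f).

Definition inclusion : functor full_sub C :=
  @Functor full_sub C (fun a => projT1 a) (fun _ _ f => f)
    (fun _ => erefl) (fun _ _ _ _ _ => erefl).

End FullSubcategory.

Section LinearMaps.
Variables (A : pzRingType) (U V : lmodType A).
Implicit Types f g h : {linear U -> V}.

Lemma linear_ext f g : (forall x, f x = g x) -> f = g.
Proof.
case: f => f [[f1] [f2]]; case: g => g [[g1] [g2]] /= fg.
have {}fg : f = g by apply/funext.
case: g / fg g1 g2 => g1 g2.
by rewrite (Prop_irrelevance f1 g1) (Prop_irrelevance f2 g2).
Qed.

Definition lin_zero : {linear U -> V} := \0.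
Definition lin_opp f : {linear U -> V} := \- f.
Definition lin_add f g : {linear U -> V} := f \+ g.

Fact lin_addA : associative lin_add.
Proof. by move=> f g h; apply: linear_ext => x /=; rewrite addrA. Qed.
Fact lin_addC : commutative lin_add.
Proof. by move=> f g; apply: linear_ext => x /=; rewrite addrC. Qed.
Fact lin_add0 : left_id lin_zero lin_add.
Proof. by move=> f; apply: linear_ext => x /=; rewrite add0r. Qed.
Fact lin_addN : left_inverse lin_zero lin_opp lin_add.
Proof. by move=> f; apply: linear_ext => x /=; rewrite addNr. Qed.

HB.instance Definition _ := GRing.isZmodule.Build {linear U -> V}
  lin_addA lin_addC lin_add0 lin_addN.

End LinearMaps.

Section Precomposition.
Variables (A : pzRingType) (U V N : lmodType A) (u : {linear U -> V}).

Definition precomp (f : {linear V -> N}) : {linear U -> N} := f \o u.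

Fact precomp_is_zmod_morphism : zmod_morphism precomp.
Proof. by move=> f g; apply: linear_ext. Qed.

HB.instance Definition _ := GRing.isZmodMorphism.Build
  {linear V -> N} {linear U -> N} precomp precomp_is_zmod_morphism.

End Precomposition.

(* Differentials are indexed by both their source and target degrees, and     *)
(* vanish unless the target degree is the successor of the source degree.     *)
(* This avoids transports along equalities between integers.                  *)
Record zcomplex := ZComplex {
  zterm :> int -> zmodType;
  zdiff : forall i j, {additive zterm i -> zterm j};
  zdiff_shape : forall i j x, j != i + 1 -> zdiff i j x = 0;
  zdiffK : forall i j k x, zdiff j k (zdiff i j x) = 0
}.
Arguments zdiff C i j : rename.

Definition zexact (C : zcomplex) : Prop :=
  forall (i : int) (x : C i),
    zdiff C i (i + 1) x = 0 -> exists y : C (i - 1), zdiff C (i - 1) i y = x.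

Section Cohomology.
Variables (C : zcomplex) (i : int).

Definition cocycle : pred (C i) := fun x => zdiff C i (i + 1) x == 0.

Fact cocycle_zmod_closed : zmod_closed cocycle.
Proof.
split=> [|x y]; rewrite /in_mem/= /cocycle; first by rewrite raddf0.
by rewrite raddfB => /eqP-> /eqP->; rewrite subrr.
Qed.

HB.instance Definition _ := GRing.isZmodClosed.Build (C i) cocycle
  cocycle_zmod_closed.

Record cocycles := Cocycles { cocycle_val : C i; _ : cocycle_val \in cocycle }.

HB.instance Definition _ := [isSub for cocycle_val].
HB.instance Definition _ := [Choice of cocycles by <:].
HB.instance Definition _ := [SubChoice_isSubZmodule of cocycles by <:].

Definition coboundary : pred cocycles :=
  fun z => `[< exists y : C (i - 1), zdiff C (i - 1) i y = val z >].

Fact coboundary_zmod_closed : zmod_closed coboundary.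
Proof.
split=> [|z t]; rewrite /in_mem/= /coboundary.
  by apply/asboolP; exists 0; rewrite raddf0.
move=> /asboolP[x xz] /asboolP[y yt]; apply/asboolP; exists (x - y).
by rewrite raddfB xz yt.
Qed.

HB.instance Definition _ := GRing.isZmodClosed.Build cocycles coboundary
  coboundary_zmod_closed.

Definition cohomology : zmodType := 
  Quotient.quot (GRing.ZmodClosed.clone cocycles coboundary _).

End Cohomology.

Section Modules.
Variable A : pzRingType.

Definition surjective (U V : lmodType A) (g : {linear U -> V}) : Prop :=
  forall v, exists u, g u = v.

Definition projective (P : lmodType A) : Prop :=
  forall (U V : lmodType A) (g : {linear U -> V}) (f : {linear P -> V}),
    surjective g -> exists h : {linear P -> U}, forall x, g (h x) = f x.

Definition finitely_generated (U : lmodType A) : Prop :=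
  exists (n : nat) (e : 'I_n -> U), forall u,
    exists c : 'I_n -> A, u = \sum_(k < n) c k *: e k.

Record complex := Complex {
  term :> int -> lmodType A;
  diff : forall i j, {linear term i -> term j};
  diff_shape : forall i j x, j != i + 1 -> diff i j x = 0;
  diffK : forall i j k x, diff j k (diff i j x) = 0
}.

Definition forget (X : complex) : zcomplex :=
  @ZComplex (fun i => X i) (@diff X) (@diff_shape X) (@diffK X).

Definition exact (X : complex) : Prop := zexact (forget X).

(* The complex Hom_A(X, N), with f |-> f \o d as differential: the usual      *)
(* signs change neither cocycles nor coboundaries.                            *)
Section HomComplex.
Variables (X : complex) (N : lmodType A).

Definition hom_term (i : int) : zmodType := {linear X (- i) -> N}.

Definition hom_diff (i j : int) : {additive hom_term i -> hom_term j} :=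
  @precomp A _ _ N (diff X (- j) (- i)).

Fact hom_diff_shape i j f : j != i + 1 -> hom_diff i j f = 0.
Proof.
move=> ji; apply: linear_ext => x /=; rewrite diff_shape ?raddf0 //.
by apply: contra ji => /eqP/(canRL (@opprK _)) ->; rewrite opprD !opprK subrK.
Qed.

Fact hom_diffK i j k f : hom_diff j k (hom_diff i j f) = 0.
Proof. by apply: linear_ext => x /=; rewrite diffK raddf0. Qed.

Definition hom_complex : zcomplex :=
  @ZComplex hom_term hom_diff hom_diff_shape hom_diffK.

End HomComplex.

Record chain_map (X Y : complex) := ChainMap {
  cm :> forall i, {linear X i -> Y i};
  cmP : forall i j x, cm j (diff X i j x) = diff Y i j (cm i x)
}.

HB.instance Definition _ X Y := gen_eqMixin (chain_map X Y).
HB.instance Definition _ X Y := gen_choiceMixin (chain_map X Y).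

Definition homotopic (X Y : complex) (f g : chain_map X Y) : Prop :=
  exists h : forall i j, {linear X i -> Y j}, forall i x,
    f i x - g i x =
      diff Y (i - 1) i (h i (i - 1) x) + h (i + 1) i (diff X i (i + 1) x).

Lemma homotopic_refl X Y (f : chain_map X Y) : homotopic f f.
Proof. by exists (fun _ _ => 0) => i x; rewrite subrr raddf0 addr0. Qed.

Lemma homotopic_sym X Y (f g : chain_map X Y) : homotopic f g -> homotopic g f.
Proof.
case=> h fg; exists (fun i j => - h i j) => i x.
by rewrite -opprB fg opprD /= raddfN.
Qed.

Lemma homotopic_trans X Y (f g k : chain_map X Y) :
  homotopic f g -> homotopic g k -> homotopic f k.
Proof.
case=> h fg [h' gk]; exists (fun i j => h i j + h' i j) => i x.
by rewrite -(subrKA (g i x)) fg gk /= raddfD addrACA.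
Qed.

Section HomotopyClasses.
Variables X Y : complex.

Definition homotopicb : rel (chain_map X Y) := fun f g => `[< homotopic f g >].

Fact homotopicb_refl : reflexive homotopicb.
Proof. by move=> f; apply/asboolP/homotopic_refl. Qed.
Fact homotopicb_sym : symmetric homotopicb.
Proof.
by move=> f g; apply: asbool_equiv_eq; split; apply: homotopic_sym.
Qed.
Fact homotopicb_trans : transitive homotopicb.
Proof.
move=> g f k /asboolP fg /asboolP gk; apply/asboolP; exact: homotopic_trans gk.
Qed.

Canonical homotopicb_equiv :=
  EquivRel homotopicb homotopicb_refl homotopicb_sym homotopicb_trans.

Definition homotopy_class := {eq_quot homotopicb}.
HB.instance Definition _ := Choice.on homotopy_class.
HB.instance Definition _ := EqQuotient.on homotopy_class.

Definition hclass (f : chain_map X Y) : homotopy_class := \pi_homotopy_class f.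

Lemma hclassP (f g : chain_map X Y) : homotopic f g <-> hclass f = hclass g.
Proof.
by split=> [fg|/eqmodP/asboolP//]; apply/eqmodP/asboolP.
Qed.

Lemma hclassK (f : homotopy_class) : hclass (repr f) = f.
Proof. exact: reprK. Qed.

End HomotopyClasses.

Definition cm_id (X : complex) : chain_map X X :=
  @ChainMap X X (fun=> idfun) (fun _ _ _ => erefl).

Section ChainMapComposition.
Variables (X Y Z : complex).

Fact cm_comp_subproof (g : chain_map Y Z) (f : chain_map X Y) i j x :
  (g j \o f j) (diff X i j x) = diff Z i j ((g i \o f i) x).
Proof. by rewrite /= !cmP. Qed.

Definition cm_comp (g : chain_map Y Z) (f : chain_map X Y) : chain_map X Z :=
  @ChainMap X Z (fun i => g i \o f i) (cm_comp_subproof g f).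

Lemma homotopic_comp (g g' : chain_map Y Z) (f f' : chain_map X Y) :
  homotopic g g' -> homotopic f f' ->
  homotopic (cm_comp g f) (cm_comp g' f').
Proof.
case=> h gg' [k ff'].
exists (fun i j => (h i j \o f i) \+ (g' j \o k i j)) => i x /=.
rewrite linearD addrACA -(cmP g') (cmP f) -gg' -linearD -ff' linearB.
by rewrite subrKA.
Qed.

Definition hc_comp (g : homotopy_class Y Z) (f : homotopy_class X Y) :
  homotopy_class X Z := hclass (cm_comp (repr g) (repr f)).

Lemma hc_compE (g : chain_map Y Z) (f : chain_map X Y) :
  hc_comp (hclass g) (hclass f) = hclass (cm_comp g f).
Proof.
by apply/hclassP/homotopic_comp; apply/hclassP; rewrite hclassK.
Qed.

End ChainMapComposition.

Definition hc_id X : homotopy_class X X := hclass (cm_id X).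

Lemma chain_map_ext X Y (f g : chain_map X Y) :
  (forall i x, f i x = g i x) -> f = g.
Proof.
case: f g => f fP [g gP] /= fg.
have {}fg : f = g by apply: functional_extensionality_dep => i; exact: linear_ext (fg i).
by case: g / fg gP => gP; rewrite (Prop_irrelevance fP gP).
Qed.

Fact hc_comp1m X Y (f : homotopy_class X Y) : hc_comp (hc_id Y) f = f.
Proof.
by rewrite -[f]hclassK hc_compE; congr hclass; apply: chain_map_ext.
Qed.

Fact hc_compm1 X Y (f : homotopy_class X Y) : hc_comp f (hc_id X) = f.
Proof.
by rewrite -[f]hclassK hc_compE; congr hclass; apply: chain_map_ext.
Qed.

Fact hc_compA X Y Z W (h : homotopy_class Z W) (g : homotopy_class Y Z)
  (f : homotopy_class X Y) : hc_comp h (hc_comp g f) = hc_comp (hc_comp h g) f.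
Proof.
rewrite -[f]hclassK -[g]hclassK -[h]hclassK !hc_compE.
by congr hclass; apply: chain_map_ext.
Qed.

Definition K : category := Category hc_comp1m hc_compm1 hc_compA.

Definition KPro : category :=
  full_sub (fun X : K => forall i, projective (X i)).

Definition KPro_complex (X : KPro) : complex := projT1 X.

Definition totally_acyclic (X : KPro) : Prop :=
  exact (KPro_complex X) /\
  forall Q : lmodType A, projective Q ->
    zexact (hom_complex (KPro_complex X) Q).

Definition KE : category := full_sub totally_acyclic.

Definition KE_complex (E : KE) : complex := KPro_complex (projT1 E).

Definition e_incl : functor KE KPro := inclusion totally_acyclic.

Definition lin_id (U : lmodType A) : {linear U -> U} := idfun.
Definition lin_comp (U V W : lmodType A) (g : {linear V -> W})
  (f : {linear U -> V}) : {linear U -> W} := g \o f.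

Fact lin_comp1m (U V : lmodType A) (f : {linear U -> V}) : lin_comp (lin_id V) f = f.
Proof. exact: linear_ext. Qed.
Fact lin_compm1 (U V : lmodType A) (f : {linear U -> V}) : lin_comp f (lin_id U) = f.
Proof. exact: linear_ext. Qed.
Fact lin_compA (U V W Z : lmodType A) (h : {linear W -> Z}) (g : {linear V -> W})
  (f : {linear U -> V}) : lin_comp h (lin_comp g f) = lin_comp (lin_comp h g) f.
Proof. exact: linear_ext. Qed.

Definition Mod : category := Category lin_comp1m lin_compm1 lin_compA.

(* The augmentation eps is the degree 0 component of the chain map from P to  *)
(* the complex M concentrated in degree 0.                                    *)
Definition projective_resolution (P : complex) (M : lmodType A)
    (eps : {linear P 0 -> M}) : Prop :=
  [/\ forall i, projective (P i),
      forall i, 0 < i -> forall x : P i, x = 0,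
      surjective eps,
      forall x : P 0, eps x = 0 <-> exists y, diff P (-1) 0 y = x
    & forall i, i < 0 -> forall x : P i,
        diff P i (i + 1) x = 0 -> exists y, diff P (i - 1) i y = x].

Definition resolves (P : complex) (M : lmodType A) : Prop :=
  exists eps : {linear P 0 -> M}, projective_resolution eps.

Definition KRes : category :=
  full_sub (fun P : KPro => exists M, resolves (KPro_complex P) M).

Definition KRes_incl : functor KRes KPro := inclusion _.

Definition complete_resolution (T : KE) (M : lmodType A) : Prop :=
  (forall i, finitely_generated (KE_complex T i)) /\
  exists (P : complex) (eps : {linear P 0 -> M}) (t : chain_map (KE_complex T) P),
    projective_resolution eps /\
    exists n : int, forall i, i <= n -> bijective (t i).

End Modules.

(* Main.v *)
(* Let t : T -> P be a chain map between complexes of projectives that is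
   bijective in low degrees. Postcomposition with t induces a bijection
   Hom_K(E, T) -> Hom_K(E, P) for every E in E(A): a chain map (resp. homotopy)
   out of E which is prescribed in degrees <= n extends upwards one degree at a
   time, since Hom_A(E, Q) is exact for Q projective. Hence T has the universal
   property of e^! P. As res is an equivalence, P is isomorphic in K(Pro A) to
   res L for some L, and comparing degree-0 cohomology gives L = M up to
   isomorphism, so T and e^! (res M) are homotopy equivalent. *)

From HB Require Import structures.
Require Import Defs.
From mathcomp Require Import all_boot all_order all_algebra.
From mathcomp Require Import all_classical prodnormedzmodule.
From mathcomp Require Import zify.

Set Implicit Arguments.
Unset Strict Implicit.
Unset Printing Implicit Defensive.

Import Order.TTheory GRing.Theory Num.Theory.
Local Open Scope ring_scope.

(* vector.hom and filter.fmap shadow the categorical notions. *)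
Local Notation hom := Defs.hom.
Local Notation fmap := Defs.fmap.

(** * Upward extension of chain maps and homotopies, one degree at a time *)

(** Stage [G k] satisfies [R] below degree [n + k], and later stages agree with it up to that
    degree; hence degree [i] can be read off stage [|i - n|]. *)
Lemma int_dependent_choice (D : int -> Type)
    (R : forall i, D i -> D (i + 1) -> Prop) (n : int) (g : forall i, D i) :
  (forall i, i < n -> R i (g i) (g (i + 1))) ->
  (forall i x y, R i x y -> exists z, R (i + 1) y z) ->
  exists g' : forall i, D i,
    (forall i, i <= n -> g' i = g i) /\ forall i, R i (g' i) (g' (i + 1)).
Proof.
move=> Rg Rstep.
pose good (m : int) (f : forall i, D i) :=
  forall i, i < m -> R i (f i) (f (i + 1)).
(* The premise [good m f] sits under the existential so that [choice] yields a total function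
   [next]. *)
have ext m f : exists f', good m f ->
    (forall i, i <= m -> f' i = f i) /\ good (m + 1) f'.
  have [fm|nfm] := pselect (good m f); last by exists f.
  have [z Rz] : exists z : D (m + 1), R m (f m) z.
    have /Rstep : R (m - 1) (f (m - 1)) (f (m - 1 + 1)) by apply: fm; lia.
    by rewrite subrK.
  pose f' := dfwith f (m + 1) z; exists f' => _.
  have f'E i : i <= m -> f' i = f i.
    by move=> im; apply: dfwithout; apply/eqP; lia.
  split=> // i; rewrite ltzD1 le_eqVlt => /predU1P[->|im].
    by rewrite f'E // /f' dfwithin.
  by rewrite !f'E; [exact: fm | lia | lia].
have [next nextP] := choice (fun mf => ext mf.1 mf.2).
pose G := fix G k := if k is k'.+1 then next (n + k'%:Z, G k') else g.
have goodG k : good (n + k%:Z) (G k).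
  elim: k => [|k IHk]; first by rewrite addr0.
  have [_] := nextP (n + k%:Z, G k) IHk.
  by rewrite /= -addrA (_ : k%:Z + 1 = k.+1) //; lia.
have GS k l i : i <= n + k%:Z -> G (l + k)%N i = G k i.
  move=> ik; elim: l => // l <-.
  have [/(_ i) GSi _] := nextP (n + (l + k)%N%:Z, _) (goodG (l + k)%N).
  by apply: GSi => /=; lia.
have GE k l i : i <= n + k%:Z -> i <= n + l%:Z -> G k i = G l i.
  move=> ik il; have [kl|/ltnW lk] := leqP k l.
    by rewrite -(subnK kl) GS.
  by rewrite -(subnK lk) GS.
exists (fun i => G `|i - n|%N i); split=> [i im|i].
  by rewrite (GE _ 0%N) //=; lia.
(* Consecutive degrees are read off different stages; the stage used for [i + 1] is also valid in
   degree [i]. *)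
have -> : G `|i - n|%N i = G `|(i + 1)%R - n|%N i by apply: GE; lia.
by apply: (goodG `|(i + 1)%R - n|%N); lia.
Qed.

Section Extension.
Variable A : pzRingType.

Lemma linear_inverse (U V : lmodType A) (f : {linear U -> V}) :
  bijective f -> exists g : {linear V -> U}, cancel f g /\ cancel g f.
Proof.
case=> g fK gK; have g_lin : linear g.
  by move=> a u v; apply: (can_inj fK); rewrite linearP !gK.
pose g' := GRing.isLinear.Build A V U *:%R g g_lin.
by exists (HB.pack_for {linear V -> U} g g').
Qed.

(** A map vanishing on boundaries is a cocycle of the complex of maps from [E] to [Q]; writing it as
    a coboundary factors it through the differential. *)
Lemma hom_exact_extend (E : complex A) (Q : lmodType A) (i : int)
    (f : {linear E i -> Q}) :
  zexact (hom_complex E Q) ->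
  (forall x, f (diff E (i - 1) i x) = 0) ->
  exists g : {linear E (i + 1) -> Q}, forall x, g (diff E i (i + 1) x) = f x.
Proof.
(* Degree [j] of [hom_complex] consists of maps out of [E (- j)], so the three degrees are renamed
   as opposites to avoid transports. *)
move=> exEQ fd; have [j def_i] : exists j, i = - j by exists (- i); rewrite opprK.
have [k def_k] : exists k, i + 1 = - k by exists (- (i + 1)); rewrite opprK.
have [l def_l] : exists l, i - 1 = - l by exists (- (i - 1)); rewrite opprK.
have def_kj : k = j - 1 by lia.
have def_lj : l = j + 1 by lia.
rewrite def_k; rewrite def_l in fd; subst i k l.
have [|g gf] := exEQ j f; first by apply: linear_ext.
by exists g => x; rewrite -gf.
Qed.

(** The last component followed by the differential of [X] kills the boundaries of [E]; its
    factorisation through the differential of [E] is the next component. *)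
Lemma chain_map_extend (E X : complex A) (n : int)
    (g : forall i, {linear E i -> X i}) :
  (forall i, zexact (hom_complex E (X i))) ->
  (forall i, i < n -> forall x,
     g (i + 1) (diff E i (i + 1) x) = diff X i (i + 1) (g i x)) ->
  exists f : chain_map E X, forall i, i <= n -> f i = g i.
Proof.
move=> exEX gd.
pose R i (u : {linear E i -> X i}) (v : {linear E (i + 1) -> X (i + 1)}) :=
  forall x, v (diff E i (i + 1) x) = diff X i (i + 1) (u x).
have [i x y xy|f [fg fd]] := int_dependent_choice (R := R) gd.
  have [u|z zP] := @hom_exact_extend E (X (i + 1 + 1)) (i + 1)
                     (diff X (i + 1) (i + 1 + 1) \o y) (exEX _).
    by move: u; rewrite addrK => u /=; rewrite xy diffK.
  by exists z.
have fP i j x : f j (diff E i j x) = diff X i j (f i x).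
  by have [->|ij] := eqVneq j (i + 1); [exact: fd | rewrite !diff_shape ?raddf0].
by exists (ChainMap fP).
Qed.

(** The defect [f - g - d s'] in degree [i + 1] kills the boundaries of [E]; its factorisation is
    the next component of the homotopy. *)
Lemma homotopy_extend (E X : complex A) (n : int) (f g : chain_map E X)
    (h : forall i j, {linear E i -> X j}) :
  (forall i, zexact (hom_complex E (X i))) ->
  (forall i, i <= n -> forall x,
     f i x - g i x =
       diff X (i - 1) i (h i (i - 1) x) + h (i + 1) i (diff E i (i + 1) x)) ->
  homotopic f g.
Proof.
move=> exEX hP.
pose R i (s : forall j, {linear E i -> X j})
    (s' : forall j, {linear E (i + 1) -> X j}) :=
  forall x, f i x - g i x =
    diff X (i - 1) i (s (i - 1) x) + s' i (diff E i (i + 1) x).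
(* The identity in degree [i] involves [h] out of degrees [i] and [i + 1], so knowing it for
   [i <= n] means knowing [R i] for [i < n + 1]. *)
have [i|i s s' ss'|h' [_ h'P]] := @int_dependent_choice _ R (n + 1) h; last first.
- by exists h'.
- pose r : {linear E (i + 1) -> X (i + 1)} :=
    (f (i + 1) \- g (i + 1)) \- (diff X i (i + 1) \o s' i).
  have [u|z zP] := @hom_exact_extend E (X (i + 1)) (i + 1) r (exEX _).
    move: u; rewrite addrK => u /=.
    by rewrite !cmP -linearB ss' linearD diffK add0r subrr.
  (* Only the component into degree [i + 1] enters the identity; the others are set to zero. *)
  exists (dfwith (fun j => 0 : {linear E (i + 1 + 1) -> X j}) (i + 1) z) => x.
  by rewrite dfwithin zP addrK /= [RHS]addrC subrK.
by rewrite ltzD1 => /hP.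
Qed.

End Extension.

(** * Cohomology classes and induced maps *)

Section CohomologyClasses.
Variables (C : zcomplex) (i : int).

Definition cohomology_class (z : cocycles C i) : cohomology C i :=
  (\pi_(cohomology C i) z)%qT.

Lemma cohomology_classP (z t : cocycles C i) :
  cohomology_class z = cohomology_class t <->
  exists y, zdiff C (i - 1) i y = val z - val t.
Proof.
rewrite /cohomology_class; split=> [/eqP|zt]; last apply/eqP; rewrite -Quotient.idealrBE.
  by move/asboolP.
exact/asboolP.
Qed.

Lemma cohomology_classB (z t : cocycles C i) :
  cohomology_class (z - t) = cohomology_class z - cohomology_class t.
Proof. exact: raddfB. Qed.

Lemma cohomology_class_repr (q : cohomology C i) : cohomology_class (repr q) = q.
Proof. exact: reprK. Qed.

End CohomologyClasses.

(** The map is computed on chosen representatives; [aB] makes the class independent of that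
    choice. *)
Lemma cohomology_map (C D : zcomplex) (i : int) (a : {additive C i -> D i}) :
  (forall z, zdiff C i (i + 1) z = 0 -> zdiff D i (i + 1) (a z) = 0) ->
  (forall y, exists y', zdiff D (i - 1) i y' = a (zdiff C (i - 1) i y)) ->
  exists phi : {additive cohomology C i -> cohomology D i},
    forall z : cocycles C i, exists2 t : cocycles D i,
      val t = a (val z) & phi (cohomology_class z) = cohomology_class t.
Proof.
move=> aZ aB.
have acocycle (z : cocycles C i) : a (val z) \in @cocycle D i.
  by apply/eqP/aZ/eqP; case: z.
pose a' z := Cocycles (acocycle z).
pose phi (q : cohomology C i) := cohomology_class (a' (repr q)).
have phiE z : phi (cohomology_class z) = cohomology_class (a' z).
  apply/cohomology_classP; rewrite /= -raddfB.
  have /cohomology_classP[y <-] := cohomology_class_repr (cohomology_class z).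
  exact: aB.
have phi_additive : zmod_morphism phi.
  move=> p q; rewrite -[p]cohomology_class_repr -[q]cohomology_class_repr.
  rewrite -cohomology_classB !phiE -cohomology_classB; congr cohomology_class.
  by apply: val_inj; rewrite /= raddfB.
pose phi' := GRing.isZmodMorphism.Build _ _ phi phi_additive.
exists (HB.pack_for {additive cohomology C i -> cohomology D i} phi phi').
by move=> z; exists (a' z) => //=; rewrite phiE.
Qed.

Lemma cohomology_iso (C D : zcomplex) (i : int)
    (a : {additive C i -> D i}) (b : {additive D i -> C i}) :
  (forall z, zdiff C i (i + 1) z = 0 -> zdiff D i (i + 1) (a z) = 0) ->
  (forall y, exists y', zdiff D (i - 1) i y' = a (zdiff C (i - 1) i y)) ->
  (forall z, zdiff D i (i + 1) z = 0 -> zdiff C i (i + 1) (b z) = 0) ->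
  (forall y, exists y', zdiff C (i - 1) i y' = b (zdiff D (i - 1) i y)) ->
  (forall z, zdiff C i (i + 1) z = 0 ->
     exists y, zdiff C (i - 1) i y = b (a z) - z) ->
  (forall z, zdiff D i (i + 1) z = 0 ->
     exists y, zdiff D (i - 1) i y = a (b z) - z) ->
  exists phi : {additive cohomology C i -> cohomology D i}, bijective phi.
Proof.
move=> aZ aB bZ bB ba ab.
have [phi phiP] := cohomology_map aZ aB.
have [psi psiP] := cohomology_map bZ bB.
exists phi; exists psi => q; rewrite -[q]cohomology_class_repr; set z := repr q.
  have [t tz ->] := phiP z; have [s st ->] := psiP t.
  by apply/cohomology_classP; rewrite st tz; apply/ba/eqP; case: (z).
have [t tz ->] := psiP z; have [s st ->] := phiP t.
by apply/cohomology_classP; rewrite st tz; apply/ab/eqP; case: (z).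
Qed.

(** * Homotopy invariance of the cohomology of Hom complexes *)

Section HomotopyInvariance.
Variables (A : pzRingType) (N : lmodType A) (i : int).

Lemma precomp_cocycle (X Y : complex A) (f : chain_map X Y)
    (z : hom_complex Y N i) :
  zdiff (hom_complex Y N) i (i + 1) z = 0 ->
  zdiff (hom_complex X N) i (i + 1) (precomp (f (- i)) z) = 0.
Proof.
move=> dz; apply: linear_ext => x /=; rewrite cmP.
by have /(congr1 (fun u : {linear _ -> _} => u (f _ x))) := dz.
Qed.

Lemma precomp_coboundary (X Y : complex A) (f : chain_map X Y)
    (y : hom_complex Y N (i - 1)) :
  exists y', zdiff (hom_complex X N) (i - 1) i y' =
    precomp (f (- i)) (zdiff (hom_complex Y N) (i - 1) i y).
Proof.
exists (precomp (f (- (i - 1))) y).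
by apply: linear_ext => x /=; rewrite cmP.
Qed.

(** Since [z] kills boundaries, composing [f - id = d h + h d] with [z] leaves [z h d], the
    coboundary of [z h]. *)
Lemma precomp_homotopic (X : complex A) (f : chain_map X X)
    (z : hom_complex X N i) :
  homotopic f (cm_id X) ->
  zdiff (hom_complex X N) i (i + 1) z = 0 ->
  exists y, zdiff (hom_complex X N) (i - 1) i y = precomp (f (- i)) z - z.
Proof.
case=> h fh dz; exists (precomp (h (- (i - 1)) (- i)) z).
apply: linear_ext => x /=.
have := fh (- i) x.
rewrite (_ : - i - 1 = - (i + 1)) 1?(_ : - i + 1 = - (i - 1)); try lia.
move=> /(congr1 z); rewrite linearB linearD /= => ->.
have /(congr1 (fun u : {linear _ -> _} => u (h _ _ x))) /= -> := dz.
by rewrite add0r.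
Qed.

Lemma cohomology_homotopy_equivalence (X Y : complex A)
    (f : chain_map X Y) (g : chain_map Y X) :
  homotopic (cm_comp g f) (cm_id X) -> homotopic (cm_comp f g) (cm_id Y) ->
  exists phi : {additive cohomology (hom_complex Y N) i ->
                         cohomology (hom_complex X N) i}, bijective phi.
Proof.
move=> gf fg.
apply: (@cohomology_iso (hom_complex Y N) (hom_complex X N) i
         (@precomp A _ _ N (f (- i))) (@precomp A _ _ N (g (- i)))).
- exact: precomp_cocycle.
- exact: precomp_coboundary.
- exact: precomp_cocycle.
- exact: precomp_coboundary.
- move=> z /(precomp_homotopic fg)[y yE]; exists y.
  by rewrite yE; congr (_ - _); apply: linear_ext.
- move=> z /(precomp_homotopic gf)[y yE]; exists y.
  by rewrite yE; congr (_ - _); apply: linear_ext.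
Qed.

End HomotopyInvariance.

(** * Isomorphisms and uniqueness of coreflections *)

Definition isomorphic (C : category) (a b : C) : Prop :=
  exists (u : hom a b) (v : hom b a), cmp v u = idm a /\ cmp u v = idm b.

Lemma isomorphic_trans (C : category) (a b c : C) :
  isomorphic a b -> isomorphic b c -> isomorphic a c.
Proof.
move=> [u [v [vu uv]]] [u' [v' [vu' uv']]]; exists (cmp u' u), (cmp v v'); split.
  by rewrite cmpA -(cmpA v) vu' cmpm1.
by rewrite cmpA -(cmpA u') uv cmpm1.
Qed.

Lemma isomorphic_fmap (C D : category) (F : functor C D) (a b : C) :
  isomorphic a b -> isomorphic (F a) (F b).
Proof.
move=> [u [v [vu uv]]]; exists (fmap F u), (fmap F v).
by rewrite -!fmapM vu uv !fmap1.
Qed.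

(** The two hypotheses on [t] give it the universal property of the counit at [b]. *)
Lemma coreflection_unique (C : category) (S : C -> Prop)
    (G : functor C (full_sub S)) (adj : adjunction (inclusion S) G)
    (a : full_sub S) (b : C) (t : hom (inclusion S a) b) :
  (forall (c : full_sub S) (f : hom (inclusion S c) b),
     exists g : hom c a, cmp t (fmap (inclusion S) g) = f) ->
  (forall (c : full_sub S) (g g' : hom c a),
     cmp t (fmap (inclusion S) g) = cmp t (fmap (inclusion S) g') -> g = g') ->
  isomorphic a (G b).
Proof.
move=> t_surj t_inj.
(* [c] is the counit at [b], and [v] factors it through [t]. *)
have [c cP] : exists c, adj_hom adj c = idm (G b).
  by have [k _ hK] := adj_bij adj (G b) b; exists (k (idm (G b))).
have [v tv] := t_surj _ c.
pose u := adj_hom adj t; exists u, v; split; last first.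
  by rewrite -adj_natl tv.
apply: t_inj; rewrite fmapM cmpA tv fmap1 cmpm1.
apply: (bij_inj (adj_bij adj _ _)).
by rewrite adj_natl cP cmp1m.
Qed.

Section Comparison.
Variable A : pzRingType.

(** * Lifting along a chain map that is bijective in low degrees *)

Section Lifting.
Variables (E T P : complex A) (t : chain_map T P) (n : int).
Hypothesis t_bij : forall i, i <= n -> bijective (t i).
Hypothesis exET : forall i, zexact (hom_complex E (T i)).

(** The bound [i <= n] sits under the existential so that a lift can be chosen in every degree;
    above [n] it is the zero map. *)
Lemma lift_along (F : lmodType A) (i : int) (f : {linear F -> P i}) :
  exists g : {linear F -> T i}, i <= n -> forall x, t i (g x) = f x.
Proof.
have [/t_bij/linear_inverse[s [_ sK]]|] := boolP (i <= n); last by exists 0.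
by exists (s \o f) => _ x /=; rewrite sK.
Qed.

(** Inverting [t] lifts [f] strictly up to degree [n]. Above [n] the extension lifts it only up to
    homotopy, obtained by extending the zero homotopy. *)
Lemma lift_chain_map (f : chain_map E P) :
  (forall i, zexact (hom_complex E (P i))) ->
  exists g : chain_map E T, homotopic (cm_comp t g) f.
Proof.
move=> exEP; pose g i := projT1 (cid (lift_along (f i))).
have gP i : i <= n -> forall x, t i (g i x) = f i x.
  by rewrite /g; case: cid.
have [i lt_in x|k kg] := chain_map_extend (n := n) (g := g) exET.
  apply: (bij_inj (t_bij (_ : i + 1 <= n))); first lia.
  by rewrite cmP !gP ?cmP //; lia.
exists k; apply: (homotopy_extend (n := n) (h := fun _ _ => 0)) => // i le_in x.
by rewrite /= kg // gP // subrr raddf0 addr0.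
Qed.

(** In degrees [i <= n] the homotopy identity uses only components into degrees [i - 1] and [i],
    where [t] is invertible. *)
Lemma lift_homotopy (g g' : chain_map E T) :
  homotopic (cm_comp t g) (cm_comp t g') -> homotopic g g'.
Proof.
case=> h hP; pose s i j := projT1 (cid (lift_along (h i j))).
have sP i j : j <= n -> forall x, t j (s i j x) = h i j x.
  by rewrite /s; case: cid.
apply: (homotopy_extend (n := n) (h := s)) => // i le_in x.
apply: (bij_inj (t_bij le_in)); rewrite linearB linearD cmP !sP //; last lia.
exact: hP.
Qed.

End Lifting.

(** * Recovering a module from its projective resolution *)

(** The kernel of [eps] consists of boundaries, which [u] sends into the kernel of [eta]. The
    section [s] is merely set-theoretic; linearity of [f] comes from [fE]. *)
Lemma resolution_map (P Q : complex A) (M L : lmodType A)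
    (eps : {linear P 0 -> M}) (eta : {linear Q 0 -> L})
    (u : chain_map P Q) :
  projective_resolution eps -> projective_resolution eta ->
  exists f : {linear M -> L}, forall x, f (eps x) = eta (u 0 x).
Proof.
move=> [_ _ eps_surj kerP _] [_ _ _ kerQ _].
have kill x : eps x = 0 -> eta (u 0 x) = 0.
  by case/kerP=> y <-; apply/kerQ; exists (u _ y); rewrite cmP.
have [s sK] := choice eps_surj; pose f m := eta (u 0 (s m)).
have fE x : f (eps x) = eta (u 0 x).
  by apply/eqP; rewrite -subr_eq0 -!linearB kill // linearB sK subrr.
have f_lin : linear f.
  by move=> a m m'; rewrite -{1}(sK m) -{1}(sK m') -linearP fE !linearP.
pose f' := GRing.isLinear.Build A M L *:%R f f_lin.
by exists (HB.pack_for {linear M -> L} f f').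
Qed.

(** As [P] vanishes in degree 1, [f - id] in degree 0 is a boundary, hence killed by [eps]. *)
Lemma augmentation_homotopic (P : complex A) (M : lmodType A)
    (eps : {linear P 0 -> M}) (f : chain_map P P) :
  projective_resolution eps -> homotopic f (cm_id P) ->
  forall x, eps (f 0 x) = eps x.
Proof.
move=> [_ P_pos _ kerP _] [h fh] x; apply/eqP.
rewrite -subr_eq0 -linearB; apply/eqP/kerP; exists (h 0 (-1) x).
have := fh 0 x; rewrite (P_pos 1 _ (diff P 0 _ x)) // raddf0 addr0 => ->.
by [].
Qed.

Lemma isomorphic_homotopy_equivalence (X Y : K A) : isomorphic X Y ->
  exists (f : chain_map X Y) (g : chain_map Y X),
    homotopic (cm_comp g f) (cm_id X) /\ homotopic (cm_comp f g) (cm_id Y).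
Proof.
move=> [u [v [vu uv]]]; exists (repr u), (repr v).
by split; apply/hclassP; [exact: vu | exact: uv].
Qed.

Lemma resolved_modules_isomorphic (P Q : complex A) (M L : lmodType A) :
  isomorphic (P : K A) Q -> resolves P M -> resolves Q L ->
  isomorphic (M : Mod A) L.
Proof.
move=> /isomorphic_homotopy_equivalence[u [v [vu uv]]] [eps Peps] [eta Qeta].
have [f fE] := resolution_map u Peps Qeta.
have [g gE] := resolution_map v Qeta Peps.
exists f, g; split; apply: linear_ext => m /=.
  have [_ _ /(_ m)[x <-] _ _] := Peps.
  by rewrite fE gE; exact: (augmentation_homotopic Peps vu).
have [_ _ /(_ m)[x <-] _ _] := Qeta.
by rewrite gE fE; exact: (augmentation_homotopic Qeta uv).
Qed.

Lemma resolution_isomorphic_res (res : functor (Mod A) (KRes A)) :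
  equivalence res ->
  (forall M : Mod A, resolves (KPro_complex (KRes_incl A (res M))) M) ->
  forall (P : KRes A) (M : lmodType A),
  resolves (KPro_complex (KRes_incl A P)) M -> isomorphic P (res M).
Proof.
move=> [G [_ [u [v [vu uv _]]]]] res_res P M PM.
have isoP : isomorphic (res (G P)) P.
  by exists (u P), (v P); split; [exact: vu | exact: uv].
have isoM : isomorphic (G P) (M : Mod A).
  apply: (@resolved_modules_isomorphic
            (KPro_complex (KRes_incl A (res (G P)))) _ _ _ _ (res_res _) PM).
  (* Morphisms of a full subcategory are those of the ambient one, so the same pair serves in
     [K A]. *)
  have [f [g [gf fg]]] := isoP.
  by exists f, g.
have [f [g [gf fg]]] := isoP.
apply: (isomorphic_trans _ (isomorphic_fmap res isoM)).
by exists g, f.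
Qed.

End Comparison.

Theorem proposition2p7 (A : pzRingType)
  (e_shriek : functor (KPro A) (KE A))
  (adj : adjunction (e_incl A) e_shriek)
  (res : functor (Mod A) (KRes A))
  (res_resolves : forall M : Mod A,
     resolves (KPro_complex (KRes_incl A (res M))) M)
  (res_equivalence : equivalence res)
  (M : lmodType A) (T : KE A) (T_complete : complete_resolution T M)
  (N : lmodType A) (i : int) :
  exists phi : {additive
      cohomology (hom_complex (KE_complex (e_shriek (KRes_incl A (res M)))) N) i
      -> cohomology (hom_complex (KE_complex T) N) i},
    bijective phi.
Proof.
have [_ [P [eps [t [Peps [n t_bij]]]]]] := T_complete.
have P_proj : forall i, projective (P i) by case: Peps.
pose P' : KPro A := exist _ (P : K A) P_proj.
have P'_res : exists M, resolves (KPro_complex P') M by exists M, eps.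
pose P'' : KRes A := exist _ P' P'_res.
have isoP : isomorphic P'' (res M).
  by apply: resolution_isomorphic_res => //; exists eps.
have isoT : isomorphic T (e_shriek P').
  have exE (E : KE A) (Q : lmodType A) :
      projective Q -> zexact (hom_complex (KE_complex E) Q).
    by case: E => E [exE exEQ]; apply: exEQ.
  have T_proj j : projective (KE_complex T j) by case: (T) => -[].
  pose t_class : hom (e_incl A T) P' := hclass t.
  (* Existence of factorisations is lifting of chain maps; uniqueness is lifting of homotopies. *)
  apply: (coreflection_unique adj (t := t_class)) => [E f|E g g'] /=.
    have [g tg] := lift_chain_map t_bij (fun j => exE E _ (T_proj j)) (repr f)
                     (fun j => exE E _ (P_proj j)).
    exists (hclass g); rewrite -[RHS]hclassK.
    by apply: etrans (hc_compE _ _) _; apply/hclassP.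
  rewrite -[g]hclassK -[g']hclassK => tgg'.
  apply/hclassP/(lift_homotopy t_bij (fun j => exE E _ (T_proj j))).
  by apply/hclassP; rewrite -!hc_compE; exact: tgg'.
(* The resolution [P] that comes with [T] need not be [res M] itself, so [isoP] is transported
   through [e_shriek]. *)
have isoGP : isomorphic (e_shriek P') (e_shriek (KRes_incl A (res M))).
  exact: isomorphic_fmap (isomorphic_fmap (KRes_incl A) isoP).
have : isomorphic (KE_complex T : K A)
                  (KE_complex (e_shriek (KRes_incl A (res M)))).
  by have [f [g [gf fg]]] := isomorphic_trans isoT isoGP; exists f, g.
case/isomorphic_homotopy_equivalence=> f [g [gf fg]].
exact: cohomology_homotopy_equivalence gf fg.
Qed.
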